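(* Let $G$ be a finitely generated group. The following are equivalent: (a) $G$ acts properly on a finite product of locally finite trees; (b) $G$ acts properly on a finite product of uniformly bounded trees; (c) $G$ acts properly on a finite product of $d$-regular trees for some finite $d$.
   Context: Trees are simplicial trees. A locally finite tree is uniformly bounded if there is a finite upper bound for the degrees of its vertices, and $d$-regular if every vertex has degree $d$. A group acts on a finite product $P=T_1\times\cdots\times T_n$ of trees by automorphisms of the natural cube complex structure (factors may be permuted). The action is proper if the stabiliser of every vertex of $P$ is finite. *)

(* Defs.v *)
From mathcomp Require Import all_boot all_classical.

Set Implicit Arguments.
Unset Strict Implicit.
Unset Printing Implicit Defensive.

Local Open Scope classical_set_scope.
Local Open Scope card_scope.

(* Every subset of G is meant here: classically [{pred G}] is [set G]. *)
Definition finitely_generated (G : groupType) : Prop :=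
  exists s : seq G, forall H : {pred G},
    group_closed H -> {subset s <= H} -> forall g : G, g \in H.

(* A simplicial tree, given by its 1-skeleton.  It must be nonempty: with an
   empty factor, a product of trees would carry a proper action of any group.
   No degree condition is imposed.  In [tree_acyclic], the sequences [:: x; y]
   with x adjacent to y satisfy [ucycle] but are not cycles of the graph. *)
Record tree := Tree {
  vertex :> eqType;
  adj : rel vertex;
  tree_nonempty : inhabited vertex;
  adj_sym : symmetric adj;
  adj_irr : irreflexive adj;
  tree_connected : forall x y : vertex,
    exists2 p : seq vertex, path adj x p & y = last x p;
  tree_acyclic : forall c : seq vertex, ucycle adj c -> (size c <= 2)%N }.

Definition neighbours (T : tree) (v : T) : set T := [set w | adj v w].

Definition locally_finite (T : tree) : Prop :=
  forall v : T, finite_set (neighbours v).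

Definition uniformly_bounded (T : tree) : Prop :=
  exists D : nat, forall v : T, neighbours v #<= `I_D.

Definition regular_tree (d : nat) (T : tree) : Prop :=
  forall v : T, neighbours v #= `I_d.

Definition tree_cell (T : tree) (A : set T) : Prop :=
  (exists v : T, A = [set v]) \/
  (exists u v : T, adj u v /\ A = [set u; v]).

(* The vertices of T_0 x ... x T_(n-1).  The empty product (n = 0) is the
   one-vertex complex, which is also the product of a single one-vertex tree. *)
Definition product_vertex (n : nat) (T : 'I_n -> tree) : Type :=
  forall i : 'I_n, T i.

(* The cubes of the product are the products of one cell per factor.  A cube is
   recorded by its set of vertices, which determines it; its faces are the cubes
   contained in it. *)
Definition product_cube (n : nat) (T : 'I_n -> tree)
    (C : set (product_vertex T)) : Prop :=
  exists c : forall i : 'I_n, set (T i),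
    (forall i, tree_cell (c i)) /\ C = [set x | forall i, c i (x i)].

(* A cube complex automorphism is determined by its action on the vertices; it
   may permute the factors. *)
Definition cube_automorphism (n : nat) (T : 'I_n -> tree)
    (f : product_vertex T -> product_vertex T) : Prop :=
  bijective f /\
  forall C : set (product_vertex T), product_cube (f @` C) <-> product_cube C.

Definition acts_by_automorphisms (G : groupType) (n : nat) (T : 'I_n -> tree)
    (act : G -> product_vertex T -> product_vertex T) : Prop :=
  [/\ forall x, act 1%g x = x,
      forall g h x, act (g * h)%g x = act g (act h x)
    & forall g, cube_automorphism (act g)].

Definition proper_action (G : groupType) (n : nat) (T : 'I_n -> tree)
    (act : G -> product_vertex T -> product_vertex T) : Prop :=
  forall x, finite_set [set g : G | act g x = x].

Definition acts_properly_on_product (G : groupType) (n : nat)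
    (T : 'I_n -> tree) : Prop :=
  exists act : G -> product_vertex T -> product_vertex T,
    acts_by_automorphisms act /\ proper_action act.

Definition acts_properly_on_product_of (G : groupType) (P : tree -> Prop)
    : Prop :=
  exists (n : nat) (T : 'I_n -> tree),
    (forall i, P (T i)) /\ acts_properly_on_product G T.

(* Main.v *)
Require Import Defs.
From mathcomp Require Import all_boot all_classical.

(** An action of G on a product of trees is the same as an action of G on the
    disjoint union (forest) of the factors: in a product of trees two edges at a
    vertex have different directions exactly when they span a square, so a cube
    automorphism permutes the directions and acts factor by factor.

    From (a) to (b): join each base vertex by finite paths to its images under
    the generators.  The translates of these paths form a subforest that is
    connected in each factor, and its degrees are bounded because G has finitely
    many orbits on its vertices.

    From (b) to (c): hang rooted trees on the vertices until all degrees are d.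
    The added vertices are words attached to a vertex and the admissible words
    depend only on the degree of that vertex, so the action extends, fixing the
    words; stabilisers can only shrink. *)

Set Implicit Arguments.
Unset Strict Implicit.
Unset Printing Implicit Defensive.

Local Open Scope classical_set_scope.
Local Open Scope card_scope.

(** * Walks and edges of a product *)

Definition linked (V : eqType) (e : rel V) (x y : V) : Prop :=
  exists2 p : seq V, path e x p & y = last x p.

Section Linked.
Variables (V : eqType) (e : rel V).

Lemma linked_refl x : linked e x x.
Proof. by exists [::]. Qed.

Lemma linked_step x y : e x y -> linked e x y.
Proof. by move=> exy; exists [:: y] => //=; rewrite exy. Qed.

Lemma linked_trans y x z : linked e x y -> linked e y z -> linked e x z.
Proof.
move=> [p xp ->] [q yq ->]; exists (p ++ q); last by rewrite last_cat.
by rewrite cat_path xp.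
Qed.

Lemma linked_sym x y : symmetric e -> linked e x y -> linked e y x.
Proof.
move=> e_sym [p + ->]; elim: p x => [|z p IHp] x /=.
  by move=> _; exact: linked_refl.
move=> /andP[exz zp]; apply: (linked_trans (IHp _ zp)).
by apply: linked_step; rewrite e_sym.
Qed.

Lemma linked_ind (Q : V -> Prop) x y :
  (forall u v, e u v -> Q u -> Q v) -> linked e x y -> Q x -> Q y.
Proof.
move=> stepQ [p + ->]; elim: p x => [|z p IHp] x //= /andP[exz zp] Qx.
by apply: IHp zp _; apply: stepQ exz Qx.
Qed.

End Linked.

Lemma linked_homo (V W : eqType) (e : rel V) (e' : rel W) (f : V -> W) x y :
  {homo f : u v / e u v >-> e' u v} -> linked e x y -> linked e' (f x) (f y).
Proof.
move=> f_homo xy; apply: (linked_ind (Q := fun v => linked e' (f x) (f v)) _ xy).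
  by move=> u v uv /linked_trans; apply; apply/linked_step/f_homo.
exact: linked_refl.
Qed.

Section ProductEdges.
Variables (n : nat) (T : 'I_n -> tree).
Local Notation P := (product_vertex T).
Local Notation upd := eqtype.dfwith.
Implicit Types (x y z w a b c d : P) (i j k p q r s : 'I_n).

Definition edge_in i x y : Prop :=
  adj (x i) (y i) /\ forall j, j != i -> x j = y j.

Lemma edge_in_sym i x y : edge_in i x y -> edge_in i y x.
Proof. by case=> xy eqxy; split=> [|j /eqxy//]; rewrite adj_sym. Qed.

Lemma edge_in_neq i x y : edge_in i x y -> x i != y i.
Proof. by case=> + _; apply: contraTneq => ->; rewrite adj_irr. Qed.

Lemma edge_in_uniq i j x y : edge_in i x y -> edge_in j x y -> i = j.
Proof.
move=> [_ eqi] /edge_in_neq /eqP neq_j; apply: contrapT => /eqP neq_ij.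
by apply/neq_j/eqi; rewrite eq_sym.
Qed.

Lemma edge_in_upd i x (v : T i) : adj (x i) v -> edge_in i x (upd x v).
Proof.
by split=> [|j ji]; rewrite ?dfwith_in// dfwith_out// eq_sym.
Qed.

Lemma square i k x y z : i != k -> edge_in i x y -> edge_in k x z ->
  exists w, [/\ edge_in k y w, edge_in i z w, w i = y i & w k = z k].
Proof.
move=> ik [xy eqy] [xz eqz].
have ki : k != i by rewrite eq_sym.
exists (upd y (z k)); rewrite dfwith_in dfwith_out 1?eq_sym//.
split=> //; split.
- by rewrite dfwith_in -eqy.
- by move=> j jk; rewrite dfwith_out // eq_sym.
- by rewrite dfwith_out 1?eq_sym// -eqz.
- move=> j ji; case: (eqVneq k j) => [<-|kj]; first by rewrite dfwith_in.
  by rewrite dfwith_out// -eqy// eqz// eq_sym.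
Qed.

Lemma tree_no_square (U : tree) (u v w t : U) : adj u v -> adj v w ->
  adj w t -> adj t u -> u != w -> v != t -> False.
Proof.
move=> uv vw wt tu uw vt.
have neq (a b : U) : adj a b -> a != b.
  by apply: contraTneq => ->; rewrite adj_irr.
suff /tree_acyclic : ucycle (@adj U) [:: u; v; w; t] by [].
rewrite /ucycle/= uv vw wt tu/= !inE !negb_or uw vt (neq _ _ uv) (neq _ _ vw).
by rewrite (neq _ _ wt) eq_sym (neq _ _ tu).
Qed.

(** Compare coordinates around the closed walk [a b c d]. If [q = p], then [a] and [c] differ in
    coordinate [p] alone, all four edges have direction [p], and the walk is a 4-cycle in the tree
    [T p]. So [a] and [c] differ exactly in [p] and [q], and the path through [d] crosses the same
    two directions; crossing [p] first would give [d = b]. *)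
Lemma square_directions p q r s a b c d : edge_in p a b -> edge_in q b c ->
  edge_in r d c -> edge_in s a d -> a <> c -> b <> d ->
  [/\ p != s, r = p & q = s].
Proof.
move=> ab bc dc ad ac bd.
have ext x y : (forall j, x j = y j) -> x = y.
  exact: functional_extensionality_dep.
have Nab := edge_in_neq ab; have Nbc := edge_in_neq bc.
have Ndc := edge_in_neq dc; have Nad := edge_in_neq ad.
case: ab bc dc ad => [ab eab] [bc ebc] [dc edc] [ad ead].
have qp : q != p.
  apply/eqP => qp; subst q.
  have ac_off j : j != p -> a j = c j by move=> jp; rewrite eab ?ebc.
  have acp : a p != c p.
    apply/eqP => acp; apply/ac/ext => j.
    by case: (eqVneq j p) => [->//|/ac_off].
  have rp : r = p.
    apply: contrapT => /eqP rp.
    have dcp : d p = c p by apply: edc; rewrite eq_sym.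
    have sp : s = p.
      apply: contrapT => /eqP sp; case/eqP: acp.
      by rewrite -dcp; apply: ead; rewrite eq_sym.
    subst s; case/eqP: Ndc.
    by rewrite -ead// ac_off.
  subst r.
  have sp : s = p.
    apply: contrapT => /eqP sp; case/eqP: Nad.
    by rewrite ac_off// edc.
  subst s.
  have bdp : b p != d p.
    apply/eqP => bdp; apply/bd/ext => j.
    case: (eqVneq j p) => [->//|jp].
    by rewrite -eab// ead.
  by apply: (tree_no_square ab bc _ _ acp bdp); rewrite adj_sym.
have pq : p != q by rewrite eq_sym.
have ps : p != s.
  apply/eqP => ps; subst s.
  case: (eqVneq r p) => [rp|rp].
    subst r; case/eqP: Nbc.
    by rewrite -edc// -ead// eab.
  apply/bd/ext => j; case: (eqVneq j p) => [->|jp].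
    by rewrite ebc// edc// eq_sym.
  by rewrite -eab// ead.
have rp : r = p.
  apply: contrapT => /eqP rp; case/eqP: Nab.
  by rewrite ead// edc 1?eq_sym// ebc.
subst r; split=> //; apply: contrapT => /eqP qs.
have sp : s != p by rewrite eq_sym.
by case/eqP: Nad; rewrite edc// -ebc 1?eq_sym// -eab.
Qed.

(** The coordinates of [x] are replaced by those of [y] one after the other, each along a walk in
    its tree; [h m] has the first [m] replaced. Coordinates that already agree are skipped, so the
    walk uses only directions in which [x] and [y] differ, and [maps_direction_coord] relies on
    this. *)
Lemma product_ind (Q : P -> Prop) x y :
  (forall k z z', x k != y k -> edge_in k z z' -> Q z -> Q z') -> Q x -> Q y.
Proof.
move=> stepQ Qx; pose h m : P := fun j => if (j < m)%N then y j else x j.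
have -> : y = h n.
  by apply: functional_extensionality_dep => j; rewrite /h ltn_ord.
suff: forall m, (m <= n)%N -> Q (h m) by apply.
elim=> [|m IHm] mn.
  suff -> : h 0%N = x by [].
  exact: functional_extensionality_dep.
have Qm := IHm (ltnW mn); pose i := Ordinal mn.
have hS : h m.+1 = upd (h m) (y i).
  apply: functional_extensionality_dep => j.
  case: (eqVneq i j) => [<-|ij]; first by rewrite dfwith_in /h ltnSn.
  rewrite dfwith_out// /h ltnS leq_eqVlt; case: eqP => //= jm.
  by case/eqP: ij; apply/val_inj.
have h0 : h m = upd (h m) (x i).
  apply: functional_extensionality_dep => j.
  case: (eqVneq i j) => [<-|ij]; last by rewrite dfwith_out.
  by rewrite dfwith_in /h ltnn.
case: (eqVneq (x i) (y i)) => [xy|xy]; first by rewrite hS -xy -h0.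
rewrite hS; apply: (linked_ind (Q := fun v => Q (upd (h m) v)) _
  (tree_connected (x i) (y i))).
  move=> u v uv; apply: (stepQ i) => //; split=> [|j ji].
    by rewrite !dfwith_in.
  by rewrite !dfwith_out// eq_sym.
by rewrite -h0.
Qed.

Definition product_edge x y : Prop := exists i, edge_in i x y.

Lemma product_edgeP x y :
  product_edge x y <-> x <> y /\ product_cube [set x; y].
Proof.
split=> [[i xy]|[xy [c [c_cell cE]]]].
  split; first by move=> e; case/eqP: (edge_in_neq xy); rewrite e.
  exists (fun j => if j == i then [set x j; y j] else [set x j]); split.
    move=> j; case: eqP => [->|_]; last by left; exists (x j).
    by right; exists (x i), (y i); case: xy.
  case: xy => xy eqxy; apply/seteqP; split=> z /=.
    by move=> [->|->] j; case: eqP => [_|/eqP/eqxy] /=; auto.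
  move=> zc; have := zc i; rewrite eqxx/= => -[zi|zi]; [left|right];
    apply: functional_extensionality_dep => j; case: (eqVneq j i) => [->//|ji];
    have := zc j; rewrite (negbTE ji)/= => ->//.
  exact: eqxy.
have [xc yc] : (forall j, c j (x j)) /\ (forall j, c j (y j)).
  by split; [have : [set x; y] x by left|have : [set x; y] y by right];
    rewrite cE.
have [i xyi] : exists i, x i != y i.
  apply: contrapT => H; apply: xy; apply: functional_extensionality_dep => j.
  by apply: contrapT => /eqP xyj; apply: H; exists j.
exists i; split.
  case: (c_cell i) (xc i) (yc i) xyi => [[v ->]/= -> ->|]; first by rewrite eqxx.
  move=> [u [v [uv ->]]]/= [->|->] [->|->]; rewrite ?eqxx// => _.
  by rewrite adj_sym.
move=> j ji; apply: contrapT => xyj.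
(* If [x] and [y] also differed at [j], this mixed vertex would be a third vertex of the cube: it
   differs from [x] at [i] and from [y] at [j]. *)
have : [set x; y] (upd x (y i)).
  rewrite cE => k /=; case: (eqVneq i k) => [<-|ik]; rewrite ?dfwith_in//.
  by rewrite dfwith_out.
move=> [/(congr1 (fun z => z i))|/(congr1 (fun z => z j))].
  by rewrite dfwith_in => e; case/eqP: xyi.
by rewrite dfwith_out // eq_sym.
Qed.

Lemma cube_automorphism_edge f : cube_automorphism f ->
  forall x y, product_edge (f x) (f y) <-> product_edge x y.
Proof.
move=> [f_bij f_cube] x y; rewrite !product_edgeP -(f_cube [set x; y]).
have -> : f @` [set x; y] = [set f x; f y].
  by rewrite image_setU !image_set1.
by split=> -[xy ?]; split=> // e; apply: xy; [rewrite e|exact: bij_inj e].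
Qed.

End ProductEdges.

(** * Directions *)

Lemma tree_point_subproof (T : tree) : exists v : T, True.
Proof. by case: (tree_nonempty T) => v; exists v. Qed.

Definition tree_point (T : tree) : T := sval (cid (tree_point_subproof T)).

Definition base_vertex (n : nat) (T : 'I_n -> tree) : product_vertex T :=
  fun i => tree_point (T i).

(* The second clause makes the direction unique for one-vertex factors. *)
Definition maps_direction (n : nat) (T : 'I_n -> tree)
    (f : product_vertex T -> product_vertex T) (i j : 'I_n) : Prop :=
  (forall x y, edge_in i x y -> edge_in j (f x) (f y)) /\
  ((forall u v : T i, ~~ adj u v) -> j = i).

Section Directions.
Variables (n : nat) (T : 'I_n -> tree).
Local Notation P := (product_vertex T).
Local Notation upd := eqtype.dfwith.
Variable f : P -> P.
Hypothesis f_aut : cube_automorphism f.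

Let f_inj : injective f. Proof. by case: f_aut => /bij_inj. Qed.

Let f_edge i x y : edge_in i x y -> exists p, edge_in p (f x) (f y).
Proof. by move=> xy; apply/(cube_automorphism_edge f_aut); exists i. Qed.

(** Image edges of different directions would span a square. The preimage of its fourth corner
    closes a square at [x] whose two edges at [x] both have direction [i], against
    [square_directions]. *)
Lemma same_direction i p q x y y' : edge_in i x y -> edge_in i x y' ->
  edge_in p (f x) (f y) -> edge_in q (f x) (f y') -> p = q.
Proof.
move=> xy xy' fxy fxy'; apply: contrapT => /eqP pq.
have [w [yw y'w wp wq]] := square pq fxy fxy'.
case: (f_aut.1) => f' fK f'K.
have [r yr] : product_edge y (f' w).
  by apply/(cube_automorphism_edge f_aut); rewrite f'K; exists q.
have [s y's] : product_edge y' (f' w).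
  by apply/(cube_automorphism_edge f_aut); rewrite f'K; exists p.
have xw : x <> f' w.
  by move=> e; case/eqP: (edge_in_neq fxy); rewrite -wp e f'K.
have yy' : y <> y'.
  move=> e; subst y'; case/eqP: pq; exact: edge_in_uniq fxy fxy'.
by have [/eqP] := square_directions xy yr y's xy' xw yy'.
Qed.

(** By injectivity the opposite corners of a square stay distinct under [f], so [square_directions]
    applies to the image: its sides at a corner have different directions and its opposite sides are
    parallel. *)
Lemma square_image i k p q x y z : i != k -> edge_in i x y -> edge_in k x z ->
    edge_in p (f x) (f y) -> edge_in q (f x) (f z) ->
  p != q /\ forall w, edge_in i z w -> edge_in k y w -> edge_in p (f z) (f w).
Proof.
move=> ik xy xz fxy fxz.
have main w : edge_in i z w -> edge_in k y w -> p != q /\ edge_in p (f z) (f w).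
  move=> zw yw.
  have [s fyw] := f_edge yw; have [r fzw] := f_edge zw.
  have xw : f x <> f w.
    move=> /f_inj e; subst w; case/eqP: ik.
    exact: edge_in_uniq xy (edge_in_sym yw).
  have yz : f y <> f z.
    by move=> /f_inj e; subst z; case/eqP: ik; apply: edge_in_uniq xy xz.
  by have [pq e _] := square_directions fxy fyw fzw fxz xw yz; subst r.
have [w [yw zw _ _]] := square ik xy xz.
by split=> [|w' zw' yw']; [have [] := main w|have [] := main w'].
Qed.

(** The direction [p] of the image of one edge at [x0] is carried to all other vertices by
    [product_ind]. A step in direction [i] is itself an edge with image direction [p], and
    [same_direction] compares the other edges with it; a step in another direction spans a square,
    and [square_image] moves [p] to the parallel side. *)
Lemma maps_direction_exists i : exists j, maps_direction f i j.
Proof.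
case: (pselect (exists u v : T i, adj u v)) => [[u [v uv]]|H]; last first.
  exists i; split=> // x y [xy _]; exfalso; apply: H.
  by exists (x i), (y i).
pose x0 : P := upd (base_vertex T) u.
have x0y0 : edge_in i x0 (upd x0 v) by apply: edge_in_upd; rewrite /x0 dfwith_in.
have [p fx0] := f_edge x0y0; exists p; split; last first.
  by move=> H; rewrite (negbTE (H u v)) in uv.
move=> x; apply: (product_ind (x := x0)
  (Q := fun x => forall y, edge_in i x y -> edge_in p (f x) (f y))); last first.
  move=> y x0y; have [q fy] := f_edge x0y.
  by rewrite (same_direction x0y0 x0y fx0 fy).
move=> k z z' _ zz' Qz w z'w; case: (eqVneq i k) => [ik|ik].
  subst k; have [q fw] := f_edge z'w.
  by rewrite (same_direction (edge_in_sym zz') z'w (edge_in_sym (Qz _ zz')) fw).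
have [y [wy zy _ _]] := square ik z'w (edge_in_sym zz').
have [q fq] := f_edge zz'.
have [_] := square_image ik zy zz' (Qz _ zy) fq.
by apply=> //; apply: edge_in_sym.
Qed.

Lemma maps_direction_uniq i j j' :
  maps_direction f i j -> maps_direction f i j' -> j = j'.
Proof.
move=> [jE jT] [j'E j'T].
case: (pselect (exists u v : T i, adj u v)) => [[u [v uv]]|H]; last first.
  have H' (u v : T i) : ~~ adj u v by apply/negP => uv; apply: H; exists u, v.
  by rewrite jT ?j'T.
pose x0 : P := upd (base_vertex T) u.
have x0y0 : edge_in i x0 (upd x0 v) by apply: edge_in_upd; rewrite /x0 dfwith_in.
exact: edge_in_uniq (jE _ _ x0y0) (j'E _ _ x0y0).
Qed.

(** Two different directions that both have edges meet in a square, and [square_image] keeps its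
    directions apart. If only one of the two factors has an edge, then [j] is the other one, which
    would have to contain an image edge. *)
Lemma maps_direction_inj i i' j :
  maps_direction f i j -> maps_direction f i' j -> i = i'.
Proof.
move=> [iE iT] [i'E i'T].
pose x0 : P := base_vertex T.
have edge_at k (u v : T k) : adj u v ->
    edge_in k (upd x0 u) (upd (upd x0 u) v).
  by move=> uv; apply: edge_in_upd; rewrite dfwith_in.
case: (pselect (exists u v : T i, adj u v)) => [[u [v uv]]|H];
case: (pselect (exists u v : T i', adj u v)) => [[u' [v' uv']]|H'].
- apply: contrapT => /eqP ii'.
  pose x : P := upd (upd x0 u) u'.
  have xy : edge_in i x (upd x v).
    by apply: edge_in_upd; rewrite /x dfwith_out ?dfwith_in// eq_sym.
  have xz : edge_in i' x (upd x v').
    by apply: edge_in_upd; rewrite /x dfwith_in.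
  by have [/eqP] := square_image ii' xy xz (iE _ _ xy) (i'E _ _ xz).
- have e : j = i' by apply: i'T => a b; apply/negP => ab; apply: H'; exists a, b.
  subst j; case: (iE _ _ (edge_at _ _ _ uv)) => ab _; exfalso; apply: H'.
  by do 2!eexists; exact: ab.
- have e : j = i by apply: iT => a b; apply/negP => ab; apply: H; exists a, b.
  subst j; case: (i'E _ _ (edge_at _ _ _ uv')) => ab _; exfalso; apply: H.
  by do 2!eexists; exact: ab.
- have e : j = i' by apply: i'T => a b; apply/negP => ab; apply: H'; exists a, b.
  have <- : j = i by apply: iT => a b; apply/negP => ab; apply: H; exists a, b.
  by [].
Qed.

(** A walk from [x] to [y] can avoid direction [i]; by injectivity on directions its image avoids
    [j], so coordinate [j] never changes. *)
Lemma maps_direction_coord i j x y :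
  maps_direction f i j -> x i = y i -> f x j = f y j.
Proof.
move=> ij xyi.
apply: (product_ind (x := x) (Q := fun z => f x j = f z j)) => // k z z' xyk zz' ->.
have [l kl] := maps_direction_exists k.
case: (kl.1 _ _ zz') => _; apply; apply/eqP => jl; subst l.
by case/eqP: xyk; rewrite -(maps_direction_inj ij kl).
Qed.

End Directions.

Lemma maps_direction_id n (T : 'I_n -> tree) (i : 'I_n) :
  maps_direction (@id (product_vertex T)) i i.
Proof. by []. Qed.

Lemma maps_direction_comp n (T : 'I_n -> tree)
    (f g : product_vertex T -> product_vertex T) (i j k : 'I_n) :
  maps_direction g i j -> maps_direction f j k -> maps_direction (f \o g) i k.
Proof.
move=> [gE gT] [fE fT]; split=> [x y /gE/fE //|H].
by have e := gT H; subst j; rewrite fT.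
Qed.

(** * The forest of the factors *)

Definition forest (n : nat) (T : 'I_n -> tree) : eqType :=
  {i : 'I_n & vertex (T i)}.

Definition in_forest (n : nat) (T : 'I_n -> tree) (i : 'I_n) (v : T i) :
  forest T := Tagged (fun i => vertex (T i)) v.

Definition forest_adj (n : nat) (T : 'I_n -> tree) : rel (forest T) :=
  fun u v => (tag u == tag v) && adj (tagged u) (tagged_as u v).

Definition forest_action (G : groupType) (n : nat) (T : 'I_n -> tree)
    (alpha : G -> forest T -> forest T) : Prop :=
  [/\ forall u, alpha 1%g u = u,
      forall g h u, alpha (g * h)%g u = alpha g (alpha h u)
    & forall g, {homo alpha g : u v / forest_adj u v}].

(** A vertex of the product is a section of the forest, one vertex in each component. Preserving it
    is what fixing the vertex amounts to, so properness can be stated on the forest alone. *)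
Definition preserves_section (n : nat) (T : 'I_n -> tree)
    (a : forest T -> forest T) (x : product_vertex T) : Prop :=
  forall i, exists j, a (in_forest (x i)) = in_forest (x j).

Definition proper_forest_action (G : groupType) (n : nat) (T : 'I_n -> tree)
    (alpha : G -> forest T -> forest T) : Prop :=
  forall x : product_vertex T,
    finite_set [set g | preserves_section (alpha g) x].

Section Forest.
Variables (n : nat) (T : 'I_n -> tree).
Implicit Types (u v w : forest T) (i j k : 'I_n).

Lemma in_forest_inj i : injective (@in_forest n T i).
Proof. by move=> a b; exact: eq_from_Tagged. Qed.

Lemma in_forestE u : u = in_forest (tagged u).
Proof. by case: u. Qed.

Lemma in_forest_tag i u : tag u = i -> exists a : T i, u = in_forest a.
Proof. by case: u => j a /= ji; subst j; exists a. Qed.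

Lemma forest_adj_in i (a b : T i) :
  forest_adj (in_forest a) (in_forest b) = adj a b.
Proof. by rewrite /forest_adj /= eqxx tagged_asE. Qed.

Lemma forest_adjP u v : forest_adj u v ->
  exists i (a b : T i), [/\ u = in_forest a, v = in_forest b & adj a b].
Proof.
case: u v => [i a] [j b] /[dup] /andP[/eqP /= ij _]; subst j.
by rewrite -/(in_forest a) -/(in_forest b) forest_adj_in => ab; exists i, a, b.
Qed.

Lemma forest_adj_sym : symmetric (@forest_adj n T).
Proof.
move=> u v; apply/idP/idP => /forest_adjP[i [a [b [-> -> ab]]]];
by rewrite forest_adj_in adj_sym.
Qed.

Lemma forest_adj_tag u v : forest_adj u v -> tag u = tag v.
Proof. by case/andP => /eqP. Qed.

Lemma linked_in_forest i (a b : T i) :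
  linked (@forest_adj n T) (in_forest a) (in_forest b).
Proof.
apply: (linked_homo (e := @adj (T i))); last exact: tree_connected.
by move=> u v; rewrite forest_adj_in.
Qed.

Lemma linked_tag (e : rel (forest T)) u v :
  subrel e (@forest_adj n T) -> linked e u v -> tag v = tag u.
Proof.
move=> e_adj uv; apply: (linked_ind (Q := fun v => tag v = tag u) _ uv) => //.
by move=> w w' /e_adj/forest_adj_tag <-.
Qed.

End Forest.

Lemma image_tree_cell (U U' : tree) (phi : U -> U') (A : set U) :
  {homo phi : u v / adj u v} -> tree_cell A -> tree_cell (phi @` A).
Proof.
move=> phi_adj [[v ->]|[u [v [uv ->]]]]; [left|right].
  by exists (phi v); rewrite image_set1.
exists (phi u), (phi v); split; first exact: phi_adj.
by rewrite image_setU !image_set1.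
Qed.

(** * From an action on the forest to an action on the product *)

Section ForestToProduct.
Variables (G : groupType) (n : nat) (T : 'I_n -> tree).
Variable alpha : G -> forest T -> forest T.
Hypothesis alpha_act : forest_action alpha.
Implicit Types (g h : G) (x y : product_vertex T).

Let alpha1 u : alpha 1%g u = u. Proof. by case: alpha_act. Qed.
Let alphaM g h u : alpha (g * h)%g u = alpha g (alpha h u).
Proof. by case: alpha_act. Qed.
Let alpha_adj g : {homo alpha g : u v / forest_adj u v}.
Proof. by case: alpha_act. Qed.
Lemma forest_actionK g : cancel (alpha g) (alpha g^-1%g).
Proof. by move=> u; rewrite -alphaM mulVg. Qed.
Lemma forest_actionVK g : cancel (alpha g^-1%g) (alpha g).
Proof. by move=> u; rewrite -alphaM mulgV. Qed.

Definition component_action g (i : 'I_n) : 'I_n :=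
  tag (alpha g (in_forest (base_vertex T i))).
Local Notation s := component_action.

(** The action maps walks to walks, and walks stay in one component, so the base vertex in
    [component_action] stands for its whole component. *)
Lemma tag_forest_action g u : tag (alpha g u) = s g (tag u).
Proof.
case: u => i a; apply: (@linked_tag _ _ (@forest_adj n T)) => //.
exact: linked_homo (alpha_adj g) (linked_in_forest _ _).
Qed.

Lemma component_action1 i : s 1%g i = i.
Proof. by rewrite /s alpha1. Qed.

Lemma component_actionM g h i : s (g * h)%g i = s g (s h i).
Proof. by rewrite -tag_forest_action -alphaM. Qed.

Lemma component_actionK g : cancel (s g) (s g^-1%g).
Proof. by move=> i; rewrite -component_actionM mulVg component_action1. Qed.

Lemma component_actionVK g : cancel (s g^-1%g) (s g).
Proof. by move=> i; rewrite -component_actionM mulgV component_action1. Qed.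

(** Coordinate [j] is the translate of the coordinate in the component that [g] sends to [j]. The
    cast [tagged_as] would default to [x j], but by [section_actionE] the tags always agree. *)
Definition section_action g x : product_vertex T :=
  fun j => tagged_as (in_forest (x j)) (alpha g (in_forest (x (s g^-1%g j)))).
Local Notation act := section_action.

Lemma section_actionE g x j :
  in_forest (act g x j) = alpha g (in_forest (x (s g^-1%g j))).
Proof.
rewrite /act.
have /(@in_forest_tag _ _ _ _)[a ->] :
    tag (alpha g (in_forest (x (s g^-1%g j)))) = j.
  by rewrite tag_forest_action /= component_actionVK.
by rewrite tagged_asE.
Qed.

Lemma section_ext x y :
  (forall j, in_forest (x j) = in_forest (y j)) -> x = y.
Proof.
move=> xy; apply: functional_extensionality_dep => j.
exact/in_forest_inj/xy.
Qed.

Lemma section_action1 x : act 1%g x = x.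
Proof.
by apply: section_ext => j; rewrite section_actionE alpha1 invg1 component_action1.
Qed.

Lemma section_actionM g h x : act (g * h)%g x = act g (act h x).
Proof.
apply: section_ext => j.
by rewrite !section_actionE alphaM invgM component_actionM.
Qed.

Lemma product_cube_section_action g (C : set (product_vertex T)) :
  product_cube C -> product_cube (act g @` C).
Proof.
move=> [c [c_cell ->]].
(* The image cells are defined by pulling back along the inverse of [g], which avoids a transport
   from [T (s g^-1 j)] to [T j]. *)
pose c' j : set (T j) := [set v |
  c (tag (alpha g^-1%g (in_forest v))) (tagged (alpha g^-1%g (in_forest v)))].
exists c'; split=> [j|].
  have /choice[phi phiE] (a : T (s g^-1%g j)) :
      exists b : T j, in_forest b = alpha g (in_forest a).
    have [b bE] : exists b : T j, alpha g (in_forest a) = in_forest b.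
      by apply: in_forest_tag; rewrite tag_forest_action/= component_actionVK.
    by exists b.
  have -> : c' j = phi @` c (s g^-1%g j).
    apply/seteqP; split=> v; rewrite /c' /=.
      have [a aE] : exists a : T (s g^-1%g j),
          alpha g^-1%g (in_forest v) = in_forest a.
        by apply: in_forest_tag; rewrite tag_forest_action.
      rewrite aE /= => ca; exists a => //; apply: in_forest_inj.
      by rewrite phiE -aE forest_actionVK.
    by move=> [a ca <-]; rewrite phiE forest_actionK.
  apply: image_tree_cell => // a b ab.
  by rewrite -forest_adj_in !phiE; apply: alpha_adj; rewrite forest_adj_in.
have memE y : (forall j, c' j (y j)) <-> forall i, c i (act g^-1%g y i).
  rewrite /c'/=; split=> [H i|H j].
    have := H (s g i).
    by have := section_actionE g^-1%g y i; rewrite invgK => <-.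
  have := section_actionE g^-1%g y (s g^-1%g j).
  rewrite invgK component_actionVK => <- /=; exact: H.
apply/seteqP; split=> y /=.
  move=> [x cx <-]; apply/memE => i.
  by rewrite -section_actionM mulVg section_action1.
move=> /memE H; exists (act g^-1%g y) => //.
by rewrite -section_actionM mulgV section_action1.
Qed.

Lemma section_action_automorphisms : acts_by_automorphisms act.
Proof.
have actK g : cancel (act g) (act g^-1%g).
  by move=> x; rewrite -section_actionM mulVg section_action1.
split; [exact: section_action1|exact: section_actionM|move=> g; split].
  exists (act g^-1%g) => // x.
  by rewrite -section_actionM mulgV section_action1.
move=> C; split; last exact: product_cube_section_action.
move=> /(product_cube_section_action g^-1%g); rewrite image_comp.
by rewrite (eq_image_id (g := _ \o _)) // => x _ /=; exact: actK.
Qed.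

Lemma section_action_proper : proper_forest_action alpha -> proper_action act.
Proof.
move=> alpha_proper x; apply: sub_finite_set (alpha_proper x) => g /= gx i.
exists (s g i); rewrite -{2}gx section_actionE component_actionK.
by [].
Qed.

End ForestToProduct.

(** * From an action on the product to an action on the forest *)

Section ProductToForest.
Variables (G : groupType) (n : nat) (T : 'I_n -> tree).
Variable act : G -> product_vertex T -> product_vertex T.
Hypothesis act_aut : acts_by_automorphisms act.
Local Notation upd := eqtype.dfwith.
Implicit Types (g h : G) (x y : product_vertex T).

Let actM g h : act (g * h)%g = act g \o act h.
Proof. by apply/funext => x; case: act_aut. Qed.
Let act1 : act 1%g = id.
Proof. by apply/funext => x; case: act_aut. Qed.
Let act_cube g : cube_automorphism (act g).
Proof. by case: act_aut. Qed.

Definition direction_action g i : 'I_n :=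
  sval (cid (maps_direction_exists (act_cube g) i)).
Local Notation s := direction_action.

Lemma direction_actionP g i : maps_direction (act g) i (s g i).
Proof. exact: svalP (cid _). Qed.

Lemma direction_action1 i : s 1%g i = i.
Proof.
apply: (maps_direction_uniq (direction_actionP _ _)).
by rewrite act1; exact: maps_direction_id.
Qed.

Lemma direction_actionM g h i : s (g * h)%g i = s g (s h i).
Proof.
apply: (maps_direction_uniq (direction_actionP _ _)).
rewrite actM.
exact: maps_direction_comp (direction_actionP _ _) (direction_actionP _ _).
Qed.

(** The vertex is completed to a vertex of the product by base coordinates; by [factor_actionE] any
    other completion gives the same result. *)
Definition factor_action g (u : forest T) : forest T :=
  in_forest (act g (upd (base_vertex T) (tagged u)) (s g (tag u))).
Local Notation alpha := factor_action.

Lemma factor_actionE g x i :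
  alpha g (in_forest (x i)) = in_forest (act g x (s g i)).
Proof.
congr in_forest; apply: (maps_direction_coord (act_cube g) (direction_actionP g i)).
by rewrite /= dfwith_in.
Qed.

Lemma factor_action_forest : forest_action alpha.
Proof.
have lift i (a : T i) : exists x : product_vertex T, x i = a.
  by exists (upd (base_vertex T) a); rewrite dfwith_in.
split=> [[i a]|g h [i a]|g u v].
- have [x <-] := lift i a.
  by rewrite -/(in_forest (x i)) factor_actionE act1 direction_action1.
- have [x <-] := lift i a.
  rewrite -/(in_forest (x i)) (factor_actionE h) (factor_actionE g) factor_actionE.
  by rewrite actM direction_actionM.
- move=> /forest_adjP[i [a [b [-> -> ab]]]].
  have [x xa] := lift i a; subst a.
  have xy := edge_in_upd ab.
  have -> : b = upd x b i by rewrite dfwith_in.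
  rewrite !factor_actionE forest_adj_in.
  by case: (direction_actionP g i) => /(_ _ _ xy)[].
Qed.

Lemma factor_action_proper : proper_action act -> proper_forest_action alpha.
Proof.
move=> act_proper x; apply: sub_finite_set (act_proper x) => g /= gx.
apply: section_ext => j.
have sVK : s g (s g^-1%g j) = j.
  by rewrite -direction_actionM mulgV direction_action1.
(* Coordinate [j] of the translate is a vertex of the section and lies in component [j], so it is
   [x j]. *)
have [k] := gx (s g^-1%g j); rewrite factor_actionE sVK => e.
by have /= jk := congr1 tag e; rewrite e jk.
Qed.

End ProductToForest.

Lemma acts_properly_on_productP (G : groupType) (n : nat) (T : 'I_n -> tree) :
  acts_properly_on_product G T <->
  exists alpha : G -> forest T -> forest T,
    forest_action alpha /\ proper_forest_action alpha.
Proof.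
split=> [[act [act_aut act_proper]]|[alpha [alpha_act alpha_proper]]].
  exists (factor_action act_aut); split; first exact: factor_action_forest.
  exact: factor_action_proper.
exists (section_action alpha); split; first exact: section_action_automorphisms.
exact: section_action_proper.
Qed.

(** * Subforests *)

Definition restrict_rel (V : eqType) (e : rel V) (A : set V) : rel V :=
  fun u v => [&& e u v, `[< A u >] & `[< A v >]].

Lemma restrict_rel_sym (V : eqType) (e : rel V) (A : set V) :
  symmetric e -> symmetric (restrict_rel e A).
Proof. by move=> e_sym u v; rewrite /restrict_rel e_sym [X in _ && X]andbC. Qed.

Lemma linked_restrict_path (V : eqType) (e : rel V) (A : set V) x p :
  path e x p -> (forall v, v \in x :: p -> A v) ->
  forall v, v \in x :: p -> linked (restrict_rel e A) x v.
Proof.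
elim: p x => [|y p IHp] x /=.
  by move=> _ _ v; rewrite inE => /eqP ->; exact: linked_refl.
move=> /andP[xy yp] pA v; rewrite inE => /orP[/eqP ->|vp].
  exact: linked_refl.
apply: (linked_trans _ (IHp _ yp _ _ vp)); last first.
  by move=> w wp; apply: pA; rewrite inE wp orbT.
apply: linked_step; apply/and3P; split=> //; apply/asboolP/pA.
  by rewrite inE eqxx.
by rewrite !inE eqxx orbT.
Qed.

Lemma linked_sig (V : eqType) (e : rel V) (A : set V)
    (a b : {v : V | `[< A v >]}) :
  linked (restrict_rel e A) (val a) (val b) -> linked (relpre val e) a b.
Proof.
move=> ab.
suff [b' /val_inj <-] : exists2 b' : {v : V | `[< A v >]},
  val b' = val b & linked (relpre val e) a b' by [].
apply: (linked_ind (Q := fun w => exists2 b' : {v : V | `[< A v >]},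
  val b' = w & linked (relpre val e) a b') _ ab).
  move=> u v /and3P[uv _ vA] [c cu ac]; exists (Sub v vA) => //.
  by apply: (linked_trans ac); apply: linked_step; rewrite /= cu.
by exists a => //; exact: linked_refl.
Qed.

Section Subtree.
Variables (U : tree) (A : set U).
Hypothesis A_nonempty : exists v, A v.
Hypothesis A_connected :
  forall u v, A u -> A v -> linked (restrict_rel (@adj U) A) u v.

Let V : eqType := {v : U | `[< A v >]}.
Let e : rel V := relpre val (@adj U).

Let V_nonempty : inhabited V.
Proof. by have [v /asboolP Av] := A_nonempty; split; exists v. Qed.

Let e_sym : symmetric e.
Proof. by move=> u v; exact: adj_sym. Qed.

Let e_irr : irreflexive e.
Proof. by move=> u; exact: adj_irr. Qed.

Let e_connected (x y : V) : linked e x y.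
Proof.
by apply/linked_sig/A_connected; apply/asboolP; [exact: valP x|exact: valP y].
Qed.

Let e_acyclic (c : seq V) : ucycle e c -> (size c <= 2)%N.
Proof.
move=> /andP[cyc_c uniq_c]; rewrite -(size_map val); apply: (@tree_acyclic U).
by rewrite /ucycle cycle_map map_inj_uniq ?uniq_c ?andbT //; exact: val_inj.
Qed.

Definition subtree : tree :=
  Tree V_nonempty e_sym e_irr e_connected e_acyclic.

End Subtree.

Definition forest_neighbours (n : nat) (T : 'I_n -> tree) (u : forest T) :
  set (forest T) := [set v | forest_adj u v].

Lemma forest_neighbours_in (n : nat) (T : 'I_n -> tree) i (a : T i) :
  neighbours a #= forest_neighbours (in_forest a).
Proof.
have -> : forest_neighbours (in_forest a) = @in_forest n T i @` neighbours a.
  apply/seteqP; split=> v; rewrite /forest_neighbours /=.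
    move=> av; have [b vb] := in_forest_tag (esym (forest_adj_tag av)).
    by subst v; exists b => //; move: av; rewrite forest_adj_in.
  by move=> [b ab <-]; rewrite forest_adj_in.
by rewrite card_eq_sym; apply: inj_card_eq => b c _ _; exact: in_forest_inj.
Qed.

Lemma forest_neighbours_action (G : groupType) (n : nat) (T : 'I_n -> tree)
    (alpha : G -> forest T -> forest T) g u : forest_action alpha ->
  forest_neighbours (alpha g u) #= forest_neighbours u.
Proof.
move=> alpha_act; have [_ _ alpha_adj] := alpha_act.
have -> : forest_neighbours (alpha g u) = alpha g @` forest_neighbours u.
  apply/seteqP; split=> v; rewrite /forest_neighbours /=.
    move=> /(alpha_adj g^-1%g); rewrite (forest_actionK alpha_act) => uv.
    by exists (alpha g^-1%g v) => //; exact: forest_actionVK.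
  by move=> [w uw <-]; exact: alpha_adj.
by apply: inj_card_eq => v w _ _; exact: (can_inj (forest_actionK alpha_act g)).
Qed.

(* The vertices of the forest of [T'] are encoded in a set [X] on which [G]
   acts, and they project to the forest of [T]. *)
Lemma acts_properly_lift (G : groupType) (n : nat) (T T' : 'I_n -> tree)
    (alpha : G -> forest T -> forest T) (X : Type) (J : forest T' -> X)
    (beta : G -> X -> X) (R : X -> X -> Prop) (pr : forall i, T' i -> T i) :
    proper_forest_action alpha ->
    injective J ->
    (forall x, beta 1%g x = x) ->
    (forall g h x, beta (g * h)%g x = beta g (beta h x)) ->
    (forall g u, exists v, J v = beta g (J u)) ->
    (forall u v, forest_adj u v <-> R (J u) (J v)) ->
    (forall g x y, R x y -> R (beta g x) (beta g y)) ->
    (forall g u v, J v = beta g (J u) ->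
       in_forest (pr _ (tagged v)) = alpha g (in_forest (pr _ (tagged u)))) ->
  acts_properly_on_product G T'.
Proof.
move=> alpha_proper J_inj beta1 betaM J_lift adjE betaR prE.
have /choice[alpha' alpha'E] (p : G * forest T') :
  exists v, J v = beta p.1 (J p.2) by exact: J_lift.
have {}alpha'E g u : J (alpha' (g, u)) = beta g (J u) by rewrite alpha'E.
apply/acts_properly_on_productP; exists (fun g u => alpha' (g, u)); split.
  split=> [u|g h u|g u v].
  - by apply: J_inj; rewrite alpha'E.
  - by apply: J_inj; rewrite !alpha'E.
  - by move=> /adjE uv; apply/adjE; rewrite !alpha'E; exact: betaR.
move=> x; apply: sub_finite_set (alpha_proper (fun i => pr i (x i))).
move=> g /= gx i; have [j gxij] := gx i; exists j.
by have /prE /= <- := alpha'E g (in_forest (x i)); rewrite gxij.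
Qed.

Lemma bounded_seq (V W : eqType) (N : V -> set W) (K : seq V) :
  (forall k, k \in K -> finite_set (N k)) ->
  exists D, forall k, k \in K -> N k #<= `I_D.
Proof.
elim: K => [|k K IHK] KN; first by exists 0%N.
have [|D DK] := IHK; first by move=> k' k'K; apply: KN; rewrite inE k'K orbT.
have /finite_set_leP[m km] : finite_set (N k) by apply: KN; rewrite inE eqxx.
exists (maxn m D) => k'; rewrite inE => /orP[/eqP ->|/DK k'D].
  by apply: card_le_trans km _; rewrite card_le_II leq_maxl.
by apply: card_le_trans k'D _; rewrite card_le_II leq_maxr.
Qed.

(** * A cobounded invariant subforest *)

Section Subforest.
Variables (G : groupType) (n : nat) (T : 'I_n -> tree).
Variable alpha : G -> forest T -> forest T.
Hypothesis alpha_act : forest_action alpha.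
Local Notation xi i := (in_forest (base_vertex T i)).

Let alpha1 u : alpha 1%g u = u. Proof. by case: alpha_act. Qed.
Let alphaM g h u : alpha (g * h)%g u = alpha g (alpha h u).
Proof. by case: alpha_act. Qed.
Let alpha_adj g : {homo alpha g : u v / forest_adj u v}.
Proof. by case: alpha_act. Qed.

(** [K] collects the base vertices and, for each generator [g] and each [i], a path to
    [alpha g (xi i)] from the base vertex of its component. *)
Lemma spanning_paths (S : seq G) : exists K : seq (forest T),
  [/\ forall i, xi i \in K,
      forall k, k \in K -> exists i,
        linked (restrict_rel (@forest_adj n T) [set` K]) (xi i) k
    & forall g i, g \in S -> exists j,
        linked (restrict_rel (@forest_adj n T) [set` K])
          (xi j) (alpha g (xi i))].
Proof.
have /choice[q qP] (p : G * 'I_n) : exists q : seq (forest T),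
    path (@forest_adj n T) (xi (tag (alpha p.1 (xi p.2)))) q /\
    alpha p.1 (xi p.2) = last (xi (tag (alpha p.1 (xi p.2)))) q.
  case: (alpha _ _) => j a /=.
  have [q jq qa] := linked_in_forest (base_vertex T j) a.
  by exists q; split; [exact: jq|exact: qa].
pose start (p : G * 'I_n) := xi (tag (alpha p.1 (xi p.2))).
pose I := [seq (g, i) | g <- S, i <- enum 'I_n].
pose K := [seq xi i | i <- enum 'I_n] ++
  flatten [seq start p :: q p | p <- I].
have xiK i : xi i \in K.
  by rewrite mem_cat; apply/orP; left; apply: map_f; rewrite mem_enum.
have qK p : p \in I -> forall v, v \in start p :: q p -> v \in K.
  move=> pI v vp; rewrite mem_cat; apply/orP; right; apply/flattenP.
  by exists (start p :: q p) => //; exact: map_f.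
exists K; split=> //.
  move=> k; rewrite mem_cat => /orP[/mapP[i _ ->]|/flattenP[_ /mapP[p pI ->] kp]].
    by exists i; exact: linked_refl.
  exists (tag (alpha p.1 (xi p.2))).
  exact: linked_restrict_path (qP p).1 (qK p pI) _ kp.
move=> g i gS; have pI : (g, i) \in I.
  by apply/allpairsP; exists (g, i); rewrite mem_enum.
exists (tag (alpha g (xi i))).
apply: linked_restrict_path (qP (g, i)).1 (qK _ pI) _ _.
by have := mem_last (start (g, i)) (q (g, i)); rewrite -(qP (g, i)).2.
Qed.

(** [Y] is the union of the translates of [K]. The elements that move every base vertex to a vertex
    joined within [Y] to a base vertex form a subgroup [H] containing the generators, so [H] is all
    of [G]. As each point of [K] is joined to a base vertex, so is each point of [Y]. *)
Lemma cobounded_subforest : finitely_generated G ->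
  exists (K : seq (forest T)) (Y : set (forest T)),
  [/\ forall u, Y u <-> exists g k, k \in K /\ u = alpha g k,
      forall i, Y (xi i)
    & forall u v, Y u -> Y v -> tag u = tag v ->
        linked (restrict_rel (@forest_adj n T) Y) u v].
Proof.
move=> [S S_gen]; have [K [xiK K_linked S_linked]] := spanning_paths S.
pose Y := [set u | exists g k, k \in K /\ u = alpha g k].
pose eY := restrict_rel (@forest_adj n T) Y.
have eY_sym : symmetric eY by apply: restrict_rel_sym; exact: forest_adj_sym.
have KY u v :
    linked (restrict_rel (@forest_adj n T) [set` K]) u v -> linked eY u v.
  have sub k : [set` K] k -> Y k.
    by move=> kK; exists 1%g, k; rewrite alpha1.
  apply: (linked_homo (f := id)) => a b /and3P[ab /asboolP aK /asboolP bK].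
  by apply/and3P; split=> //; apply/asboolP/sub.
have alphaY g u v : linked eY u v -> linked eY (alpha g u) (alpha g v).
  have sub w : Y w -> Y (alpha g w).
    by move=> [h [k [kK ->]]]; exists (g * h)%g, k; rewrite alphaM.
  apply: linked_homo => a b /and3P[ab /asboolP aY /asboolP bY].
  by apply/and3P; split; [exact: alpha_adj|exact/asboolP/sub|exact/asboolP/sub].
have eY_tag u v : linked eY u v -> tag v = tag u.
  by apply: linked_tag => a b /and3P[].
pose H : {pred G} := fun g =>
  `[< forall i, exists j, linked eY (alpha g (xi i)) (xi j) >].
have HP g i : g \in H -> exists j, linked eY (alpha g (xi i)) (xi j).
  by move=> /asboolP.
have H_closed : group_closed H.
  split; first by apply/asboolP => i; exists i; rewrite alpha1; exact: linked_refl.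
  move=> g h gH hH; apply/asboolP => i.
  (* Closure under quotients: with [k] the component that [h] sends to [i], membership of [h] joins
     [alpha h (xi k)] to [xi i]. Applying the inverse of [h] and then [g] reduces the quotient at
     [xi i] to [g] at [xi k]. *)
  have [k ik] : exists k, linked eY (xi i) (alpha h (xi k)).
    have [j kj] := HP h (component_action alpha h^-1%g i) hH.
    exists (component_action alpha h^-1%g i); apply: linked_sym => //.
    have /= ji := eY_tag _ _ kj.
    by move: ji kj; rewrite tag_forest_action//= component_actionVK // => ->.
  have [j kj] := HP g k gH; exists j; apply: linked_trans kj.
  rewrite alphaM; apply: (alphaY g).
  by have := alphaY h^-1%g _ _ ik; rewrite forest_actionK.
have Y_linked u : Y u -> exists j, linked eY u (xi j).
  move=> [g [k [kK ->]]]; have [i ik] := K_linked k kK.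
  have gH : g \in H.
    apply: S_gen => // s sS; apply/asboolP => i'.
    by have [j ij] := S_linked s i' sS; exists j; apply: linked_sym => //; exact: KY.
  have [j ij] := HP g i gH; exists j; apply: linked_trans ij.
  by apply: (alphaY g); apply: linked_sym => //; exact: KY.
exists K, Y; split=> // [i|u v uY vY uv].
  by exists 1%g, (xi i); rewrite alpha1.
have [j uj] := Y_linked u uY; have [k vk] := Y_linked v vY.
(* Walks preserve components, and each component has one base vertex. *)
have jk : j = k by rewrite -[j]/(tag (xi j)) (eY_tag _ _ uj) uv -(eY_tag _ _ vk).
by subst k; apply: (linked_trans uj); exact: linked_sym.
Qed.

Lemma acts_properly_on_bounded : finitely_generated G ->
  (forall i, locally_finite (T i)) -> proper_forest_action alpha ->
  exists T' : 'I_n -> tree, (forall i, uniformly_bounded (T' i)) /\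
    acts_properly_on_product G T'.
Proof.
move=> G_fg T_lf alpha_proper.
have [K [Y [YE xiY Y_linked]]] := cobounded_subforest G_fg.
pose A i : set (T i) := [set v | Y (in_forest v)].
have A_nonempty i : exists v, A i v by exists (base_vertex T i); exact: xiY.
have A_connected i u v : A i u -> A i v ->
    linked (restrict_rel (@adj (T i)) (A i)) u v.
  move=> uA vA; have uv := Y_linked _ _ uA vA erefl.
  suff [v' /in_forest_inj <-] : exists2 v' : T i, in_forest v' = in_forest v &
    linked (restrict_rel (@adj (T i)) (A i)) u v' by [].
  (* The walk in the forest is followed step by step; it never leaves component [i], so it lifts to
     [T i]. *)
  apply: (linked_ind (Q := fun w => exists2 v' : T i, in_forest v' = w &
    linked (restrict_rel (@adj (T i)) (A i)) u v') _ uv); last first.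
    by exists u => //; exact: linked_refl.
  move=> a b /and3P[ab aY bY] [c ca uc].
  have [b' bE] : exists b' : T i, b = in_forest b'.
    by apply: in_forest_tag; rewrite -(forest_adj_tag ab) -ca.
  subst a b; exists b' => //; apply: (linked_trans uc); apply: linked_step.
  by rewrite /restrict_rel -(@forest_adj_in n T) ab aY bY.
pose T' i := subtree (A_nonempty i) (A_connected i).
(* A bound on the finite set [K] suffices: every vertex of [Y] is a translate of some [k] in [K] and
   has the same degree in the forest, and passing to the subtree cannot raise degrees. *)
have [D KD] : exists D, forall k, k \in K -> forest_neighbours k #<= `I_D.
  apply: bounded_seq => k _; rewrite [k]in_forestE.
  by rewrite -(eq_finite_set (forest_neighbours_in _)); exact: T_lf.
exists T'; split.
  move=> i; exists D => v.
  have [g [k [kK vk]]] : exists g k, k \in K /\ in_forest (val v) = alpha g k.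
    by apply/YE; have /asboolP := valP v.
  have val_card : val @` neighbours v #= neighbours v.
    by apply: inj_card_eq => a b _ _; exact: val_inj.
  rewrite -(card_le_eql val_card).
  apply: (@card_le_trans _ _ _ (neighbours (val v))).
    by apply: subset_card_le => _ [w vw <-].
  rewrite (card_le_eql (forest_neighbours_in _)) vk.
  rewrite (card_le_eql (forest_neighbours_action _ _ alpha_act)).
  exact: KD.
pose J (u : forest T') : forest T := in_forest (val (tagged u)).
apply: (@acts_properly_lift G n T T' alpha _ J alpha (@forest_adj n T)
  (fun i => val)) => //.
- move=> [i u] [j v]; rewrite /J/= => uv.
  have /= ij := congr1 tag uv; subst j; congr existT; apply: val_inj.
  exact: in_forest_inj uv.
- move=> g u.
  have : Y (alpha g (J u)).
    have /asboolP/YE[h [k [kK uk]]] := valP (tagged u).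
    by apply/YE; exists (g * h)%g, k; rewrite /J uk alphaM.
  case: (alpha g (J u)) => j a aY; have /asboolP aA : A j a by [].
  by exists (@in_forest n T' j (Sub a aA)).
- move=> u v; split.
    move=> /forest_adjP[i [a [b [-> -> ab]]]].
    by rewrite /J /= forest_adj_in.
  case: u v => [i a] [j b]; rewrite /J/= => ab.
  have /= ij := forest_adj_tag ab; subst j.
  rewrite -/(in_forest a) -/(in_forest b) forest_adj_in.
  by rewrite forest_adj_in in ab.
Qed.

End Subforest.

(** * Regular extensions *)

Section FreeExtension.
Variable U : tree.
Implicit Types (p q x y z : U * seq nat).

Definition is_child p q : bool :=
  [&& p.1 == q.1, q.2 != [::] & behead q.2 == p.2].

(** Each vertex [v] of [U], seen as [(v, [::])], becomes the root of the tree of all words over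
    [nat]. Words grow at the head, so the parent of a nonempty word is its tail. *)
Definition extension_adj : rel (U * seq nat) := fun p q =>
  [|| [&& p.2 == [::], q.2 == [::] & adj p.1 q.1], is_child p q | is_child q p].

Lemma is_childP p q : reflect (exists m, q = (p.1, m :: p.2)) (is_child p q).
Proof.
case: p q => [v l] [w k]; apply: (iffP and3P) => /= [[/eqP -> ]|[m [-> ->]]//].
by case: k => //= m k _ /eqP ->; exists m.
Qed.

Let extension_adj_sym : symmetric extension_adj.
Proof.
move=> p q; rewrite /extension_adj adj_sym [is_child p q || _]orbC.
by congr (_ || _); rewrite andbCA.
Qed.

Let extension_adj_irr : irreflexive extension_adj.
Proof.
move=> p; apply/negP => /or3P[/and3P[_ _]||]; first by rewrite adj_irr.
all: by case/is_childP => m /(congr1 (size \o snd)) /= /n_Sn.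
Qed.

(** Descend to the root, cross [U], and climb again. The set [A], closed under parents, lets the
    same argument serve the whole extension and [valid_words]. *)
Lemma extension_connected (A : set (U * seq nat)) :
    (forall v, A (v, [::])) ->
    (forall v m l, A (v, m :: l) -> A (v, l)) ->
  forall p q, A p -> A q -> linked (restrict_rel extension_adj A) p q.
Proof.
move=> A0 AS.
have e_sym : symmetric (restrict_rel extension_adj A) by exact: restrict_rel_sym.
have to_root v l : A (v, l) ->
    linked (restrict_rel extension_adj A) (v, l) (v, [::]).
  elim: l => [_|m l IHl vA]; first exact: linked_refl.
  apply: (linked_trans _ (IHl (AS _ _ _ vA))); apply: linked_step.
  apply/and3P; split; [|exact/asboolP|exact/asboolP/(AS _ _ _ vA)].
  by apply/or3P/Or33/is_childP; exists m.
move=> [v k] [w l] vA wA; apply: (linked_trans (to_root _ _ vA)).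
apply: (linked_trans (y := (w, [::]))); last exact/linked_sym/to_root.
apply: (linked_homo (f := fun v => (v, [::])) _ (tree_connected v w)) => a b ab.
by apply/and3P; split; [rewrite /extension_adj /= ab|exact/asboolP|exact/asboolP].
Qed.

Let extension_adj_connected p q : linked extension_adj p q.
Proof.
have := @extension_connected setT (fun=> I) (fun _ _ _ _ => I) p q I I.
by apply: (linked_homo (f := id)) => x y /and3P[].
Qed.

Lemma longest_word (c : seq (U * seq nat)) : c != [::] ->
  exists2 x, x \in c & forall y, y \in c -> (size y.2 <= size x.2)%N.
Proof.
elim: c => // x [|y c] IHc _.
  by exists x => [|z]; rewrite inE // => /eqP ->.
have [//|z zc zmax] := IHc; case: (leqP (size x.2) (size z.2)) => xz.
  exists z => [|t]; rewrite inE ?zc ?orbT// => /orP[/eqP ->//|]; exact: zmax.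
exists x => [|t]; rewrite inE ?eqxx// => /orP[/eqP ->//|/zmax tz].
exact: leq_trans tz (ltnW xz).
Qed.

Lemma shorter_neighbour x y : extension_adj x y -> x.2 != [::] ->
  (size y.2 <= size x.2)%N -> y = (x.1, behead x.2).
Proof.
move=> /or3P[/and3P[/eqP -> //]|/is_childP[m ->]|/is_childP[m ->]] /=.
  by rewrite ltnn.
by case: y.
Qed.

(* A vertex of a cycle whose word is longest and nonempty would have its parent
   as both neighbours on the cycle; hence a cycle lies in [U]. *)
Let extension_adj_acyclic (c : seq (U * seq nat)) :
  ucycle extension_adj c -> (size c <= 2)%N.
Proof.
move=> cycle_c; apply: contrapT => /negP; rewrite -ltnNge => size_c.
have [|x xc xmax] := @longest_word c; first by case: (c) size_c.
case: (eqVneq x.2 [::]) => x0.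
  have c0 y : y \in c -> y.2 = [::].
    by move=> /xmax; rewrite x0 leqn0 size_eq0 => /eqP.
  have : ucycle (@adj U) (map fst c).
    case/andP: cycle_c => cyc_c uniq_c; apply/andP; split.
      rewrite cycle_map; apply: (sub_in_cycle (P := mem c) _ _ cyc_c); last exact/allP.
      move=> y z yc zc /or3P[/and3P[]//||] /is_childP[m];
      by [move=> e; have := c0 _ zc; rewrite e|move=> e; have := c0 _ yc; rewrite e].
    rewrite map_inj_in_uniq // => -[v k] [w l] /c0/= -> /c0/= -> /= ->//.
  by move/tree_acyclic; rewrite size_map leqNgt size_c.
have [i s cE] := rot_to xc.
have : ucycle extension_adj (x :: s) by rewrite -cE /ucycle rot_cycle rot_uniq.
have sc y : y \in s -> y \in c by move=> ys; rewrite -(mem_rot i) cE inE ys orbT.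
have : (1 < size s)%N by move: size_c; rewrite -(size_rot i) cE.
case: s sc {cE} => [//|y [//|z s]] sc _ /andP[] /=.
rewrite rcons_path /= => /andP[xy /andP[_ /andP[_ last_x]]].
move=> /and3P[_ /negP yzs _]; apply: yzs.
have yE : y = (x.1, behead x.2).
  by apply: shorter_neighbour => //; apply/xmax/sc; rewrite inE eqxx.
have tE : last z s = (x.1, behead x.2).
  apply: shorter_neighbour => //; first by rewrite extension_adj_sym.
  by apply/xmax/sc; rewrite inE mem_last orbT.
by rewrite yE -tE mem_last.
Qed.

Let extension_nonempty : inhabited (U * seq nat)%type.
Proof. by split; exact: (tree_point U, [::]). Qed.

Definition free_extension : tree :=
  Tree extension_nonempty extension_adj_sym extension_adj_irr
    extension_adj_connected extension_adj_acyclic.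

End FreeExtension.

(** The value is 0 at a vertex with infinitely many neighbours. *)
Definition degree (U : tree) (v : U) : nat :=
  xget 0%N [set k | neighbours v #= `I_k].

Lemma degreeP (U : tree) (v : U) :
  finite_set (neighbours v) -> neighbours v #= `I_(degree v).
Proof.
move=> /finite_setP[k vk].
by rewrite /degree; case: xgetP => [_ -> //|/(_ k)].
Qed.

Lemma degree_eq (U U' : tree) (v : U) (w : U') :
  neighbours v #= neighbours w -> degree v = degree w.
Proof.
move=> vw; congr xget; apply/seteqP.
by split=> k /=; rewrite (card_eql vw).
Qed.

(* A vertex of [U] of degree [k] gets [d - k] children and every other vertex
   [d - 1].  Labelling them by [k <= m < d] and [1 <= m < d] leaves the labels
   below [k], respectively 0, for the other neighbours. *)
Fixpoint valid_word (d k : nat) (l : seq nat) : bool :=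
  if l is m :: l' then
    [&& (if l' is [::] then k else 1) <= m, m < d & valid_word d k l']%N
  else true.

Definition valid_words (d : nat) (U : tree) : set (free_extension U) :=
  [set p | valid_word d (degree p.1) p.2].

Section RegularExtension.
Variables (d : nat) (U : tree).

Let words_nonempty : exists p, @valid_words d U p.
Proof. by exists (tree_point U, [::]). Qed.

Let words_connected (p q : free_extension U) :
  valid_words d p -> valid_words d q ->
  linked (restrict_rel (@adj (free_extension U)) (@valid_words d U)) p q.
Proof.
apply: extension_connected => // v m l.
by rewrite /valid_words /= => /and3P[].
Qed.

Definition regular_extension : tree := subtree words_nonempty words_connected.

(** The neighbours of [(v, l)] are numbered bijectively by the numbers below [d]. A child has its
    label as number. At a root, the [k] neighbours in [U] are numbered below [k] by a bijection [f];
    elsewhere the parent has number 0. *)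
Lemma regular_extensionP : (0 < d)%N ->
    (forall v : U, neighbours v #<= `I_d) ->
  regular_tree d regular_extension.
Proof.
move=> d_gt0 U_bounded [[v l] vl_valid].
have vlP : valid_word d (degree v) l by have /asboolP := vl_valid.
have v_fin : finite_set (neighbours v).
  by apply/finite_set_leP; exists d.
have vk := degreeP v_fin; set k := degree v in vk vlP.
have kd : (k <= d)%N by rewrite -card_le_II -(card_le_eql vk).
have /card_set_bijP[f [f_fun f_inj f_surj]] := vk.
pose x : regular_extension := Sub (v, l) vl_valid.
pose F (y : regular_extension) : nat := let: (w, l') := val y in
  if (size l < size l')%N then head 0%N l'
  else if l is [::] then f w else 0%N.
have childE m : valid_word d k (m :: l) ->
  exists2 y : regular_extension, adj x y & F y = m.
  move=> ml; have yP : `[< valid_words d (v, m :: l) >] by exact/asboolP.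
  exists (Sub (v, m :: l) yP : regular_extension); last by rewrite /F /= ltnSn.
  by apply/or3P/Or32/is_childP; exists m.
have size_ltF (l' : seq nat) : ((size l').+1 < size l')%N = false.
  by rewrite ltnNge leqnSn.
pose lo := if l is [::] then k else 1%N.
have lo_d : (lo <= d)%N by rewrite /lo; case: (l).
have adjF y : adj x y ->
    (exists m, [/\ val y = (v, m :: l), F y = m & (lo <= m < d)%N]) \/
    (F y < lo)%N /\ exists w, val y = (w, behead l) /\
      if l is [::] then adj v w /\ F y = f w else w = v.
  case: y => y yP; rewrite /F /=.
  move=> /or3P[/and3P[/= /eqP l0 y0 vy]|/is_childP[m yE]|/is_childP[m]].
  - right; case: y yP y0 vy => w l' /= yP /eqP l'0 vw; subst l l'.
    by split; [exact: f_fun|exists w].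
  - left; exists m; subst y; rewrite ltnSn; split=> //.
    by have /asboolP/and3P[lo_m md _] := yP; apply/andP.
  - case: y yP => w l' yP /= [-> lE]; right.
    rewrite /lo lE /= size_ltF; split=> //.
    by exists w.
have F_image : F @` neighbours x = `I_d.
  apply/seteqP; split=> [_ [y /adjF + <-]|m /= md].
    move=> [[m [_ -> /andP[]]]|[Flo _]] //=; exact: leq_trans Flo lo_d.
  case: (leqP lo m) => [lo_m|m_lo].
    have [|y xy <-] := childE m; first by apply/and3P.
    by exists y.
  (* Numbers below [lo] come from a neighbour in [U] when the word is empty, and from the parent
     otherwise. *)
  case lE: l => [|b l']; rewrite /lo lE in m_lo.
    have [u /= vu fu] := f_surj _ m_lo.
    have uP : `[< valid_words d (u, [::]) >] by exact/asboolP.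
    exists (Sub (u, [::]) uP : regular_extension); last by rewrite /F /= lE.
    by apply/or3P/Or31/and3P; rewrite /= lE.
  have yP : `[< valid_words d (v, l') >].
    by apply/asboolP; move: vlP; rewrite lE => /and3P[].
  exists (Sub (v, l') yP : regular_extension).
    by apply/or3P/Or33/is_childP; exists b; rewrite /= lE.
  by rewrite /F lE /= size_ltF; case: (m) m_lo.
rewrite -F_image card_eq_sym; apply: inj_card_eq => y z.
rewrite !inE => /adjF yF /adjF zF FE; apply: val_inj.
case: yF zF => [[m [-> mE lo_m]]|[ylo [w [-> wE]]]]
  [[m' [-> m'E lo_m']]|[zlo [w' [-> w'E]]]].
- by rewrite -mE -m'E FE.
- by move: zlo; rewrite -FE mE ltnNge; case/andP: lo_m => ->.
- by move: ylo; rewrite FE m'E ltnNge; case/andP: lo_m' => ->.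
(* Neither neighbour is a child: both are the parent, or both lie in [U] and [f] separates them. *)
- case: (l) wE w'E => [|b l'] wE w'E; last by rewrite wE w'E.
  congr (_, _); apply: f_inj; rewrite ?inE; first by case: wE.
    by case: w'E.
  by rewrite -wE.2 -w'E.2.
Qed.
End RegularExtension.

(** The group acts on pairs of a forest vertex and a word through the first entry. Admissible words
    go to admissible words because a vertex and its translates have equal degree, and forgetting the
    word is equivariant, which gives properness. *)
Lemma acts_properly_on_regular_extension (G : groupType) (n : nat)
    (T : 'I_n -> tree) (d : nat) :
  acts_properly_on_product G T ->
  acts_properly_on_product G (fun i => regular_extension d (T i)).
Proof.
move=> /acts_properly_on_productP[alpha [alpha_act alpha_proper]].
have [alpha1 alphaM alpha_adj] := alpha_act.
pose T' i := regular_extension d (T i).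
pose J (u : forest T') : forest T * seq nat :=
  (in_forest (val (tagged u)).1, (val (tagged u)).2).
pose beta g (x : forest T * seq nat) := (alpha g x.1, x.2).
pose R (x y : forest T * seq nat) : Prop :=
  [/\ x.2 = [::], y.2 = [::] & forest_adj x.1 y.1] \/
  (exists m, y = (x.1, m :: x.2)) \/ (exists m, x = (y.1, m :: y.2)).
apply: (@acts_properly_lift G n T T' alpha _ J beta R (fun i a => (val a).1)) => //.
- move=> [i [[v k] vP]] [j [[w l] wP]] uv.
  have /= vw := congr1 fst uv; have /= kl := congr1 snd uv.
  have /= ij := congr1 tag vw; subst j; move/in_forest_inj in vw; subst w l.
  by congr existT; apply: val_inj.
- by move=> [u l]; rewrite /beta alpha1.
- by move=> g h [u l]; rewrite /beta alphaM.
- move=> g [i [[v l] vP]].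
  have [w wE] : exists w : T (tag (alpha g (in_forest v))),
      alpha g (in_forest v) = in_forest w.
    exact: in_forest_tag.
  have vw : degree v = degree w.
    apply: degree_eq; apply: (card_eq_trans (forest_neighbours_in _)).
    apply: card_esym; apply: (card_eq_trans (forest_neighbours_in _)).
    by rewrite -wE; exact: forest_neighbours_action.
  have wP : `[< @valid_words d _ (w, l) >].
    by apply/asboolP; rewrite /valid_words /= -vw; have /asboolP := vP.
  exists (@in_forest n T' _ (Sub (w, l) wP)).
  exact: (congr1 (fun u => (u, l)) (esym wE)).
- move=> u v; split.
    move=> /forest_adjP[i [[[a k] aP] [[[b l] bP] [-> ->]]]].
    move=> /or3P[/and3P[/= /eqP k0 /eqP l0 ab]|/is_childP[m]|/is_childP[m]].
    + by left; split; rewrite ?forest_adj_in.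
    + by move=> [/= ? ?]; subst b l; right; left; exists m.
    + by move=> [/= ? ?]; subst a k; right; right; exists m.
  case: u v => [i [[a k] aP]] [j [[b l] bP]] [[/= k0 l0 ab]|].
    have /= ij := forest_adj_tag ab; subst j k l.
    rewrite -!/(@in_forest n T' i _) forest_adj_in.
    by apply/or3P/Or31; rewrite /= -(@forest_adj_in n T).
  move=> [] [m e]; have /= ab := congr1 fst e; have /= kl := congr1 snd e;
  have /= ij := congr1 tag ab; subst j; move/in_forest_inj in ab; subst;
  rewrite -!/(@in_forest n T' i _) forest_adj_in; apply/or3P.
    by apply/Or32/is_childP; exists m.
  by apply/Or33/is_childP; exists m.
- move=> g x y [[x0 y0 xy]|[[m ->]|[m ->]]].
  + by left; split=> //; exact: alpha_adj.
  + by right; left; exists m.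
  + by right; right; exists m.
- by move=> g u v [].
Qed.

(** * The equivalence of the three conditions *)

Lemma uniformly_bounded_locally_finite (T : tree) :
  uniformly_bounded T -> locally_finite T.
Proof. by move=> [D TD] v; apply/finite_set_leP; exists D. Qed.

Lemma regular_tree_uniformly_bounded (d : nat) (T : tree) :
  regular_tree d T -> uniformly_bounded T.
Proof. by move=> Td; exists d => v; rewrite (card_le_eql (Td v)) card_lexx. Qed.

Lemma acts_properly_on_product_of_sub (G : groupType) (Q Q' : tree -> Prop) :
  (forall T, Q T -> Q' T) ->
  acts_properly_on_product_of G Q -> acts_properly_on_product_of G Q'.
Proof. by move=> QQ' [n [T [TQ GT]]]; exists n, T; split=> // i; exact/QQ'. Qed.

Theorem lemma6p1 (G : groupType) (hG : finitely_generated G) :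
  (acts_properly_on_product_of G locally_finite <->
   acts_properly_on_product_of G uniformly_bounded) /\
  (acts_properly_on_product_of G uniformly_bounded <->
   exists d : nat, acts_properly_on_product_of G (regular_tree d)).
Proof.
split; split.
- move=> [n [T [T_lf /acts_properly_on_productP[alpha [alpha_act alpha_proper]]]]].
  by exists n; exact: acts_properly_on_bounded alpha_act hG T_lf alpha_proper.
- exact/acts_properly_on_product_of_sub/uniformly_bounded_locally_finite.
- move=> [n [T [/choice[D TD] GT]]].
  (* One degree must serve all factors, hence the maximum; the successor makes it positive, as
     [regular_extensionP] requires. *)
  exists (\max_i D i).+1, n, (fun i => regular_extension (\max_i D i).+1 (T i)).
  split=> [i|]; last exact: acts_properly_on_regular_extension.
  apply: regular_extensionP => // v; apply: card_le_trans (TD i v) _.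
  by rewrite card_le_II; apply/leqW/leq_bigmax.
- move=> [d]; apply: acts_properly_on_product_of_sub.
  exact: regular_tree_uniformly_bounded.
Qed.
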